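(* Let $(X,T)$ be a topological dynamical system, with $d$ the metric on $X$. Suppose that $(X,T)$ is mean sensitive and that there is a mean proximal pair $(p,q)\in X\times X$ such that $p$ is a periodic point and $q$ is a transitive point. Then $(X,T)$ is mean Li-Yorke chaotic; more precisely, there exist a positive number $\eta$ and a subset $K\subset X$ which is a union of countably many Cantor sets such that $K$ is a mean Li-Yorke set with modulus $\eta$.
   Context: A topological dynamical system (TDS) is a pair $(X,T)$ where $X$ is a compact metric space with metric $d$ and $T:X\to X$ is continuous ($T$ is not assumed invertible). A point $x\in X$ is transitive if its forward orbit is dense: $\overline{\{T^n x: n\ge 0\}}=X$. A point $x$ is periodic of period $n\in\mathbb{N}$ ($n\geq 1$) if $T^n x=x$ and $T^i x\ne x$ for $1\le i\le n-1$; it is periodic if it is periodic of some period. A pair $(x,y)\in X\times X$ is mean proximal (also called forward mean proximal) if $\liminf_{n\to\infty}\frac1n\sum_{i=0}^{n-1}d(T^i x,T^i y)=0$. $(X,T)$ is mean sensitive if there exists $\delta>0$ such that for every $x\in X$ and every $\epsilon>0$ there is $y\in B(x,\epsilon)$ (the ball of radius $\epsilon$ about $x$) with $\limsup_{n\to\infty}\frac1n\sum_{i=0}^{n-1}d(T^i x,T^i y)>\delta$. A pair $(x,y)$ is a mean Li-Yorke pair if it is mean proximal and $\limsup_{n\to\infty}\frac1n\sum_{i=0}^{n-1}d(T^i x,T^i y)>0$; given $\eta>0$, it is a mean Li-Yorke pair with modulus $\eta$ if it is mean proximal and this $\limsup$ is $\ge\eta$. A subset $S\subset X$ is a mean Li-Yorke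 set (respectively, with modulus $\eta$) if every pair $(x,y)\in S\times S$ of distinct points is a mean Li-Yorke pair (respectively, with modulus $\eta$). $(X,T)$ is mean Li-Yorke chaotic if $X$ contains an uncountable mean Li-Yorke subset. A Cantor set is a subset homeomorphic to the standard Cantor space. *)

(* Defs.v *)
From mathcomp Require Import all_boot all_order all_algebra.
From mathcomp Require Import all_classical all_reals all_analysis.

Set Implicit Arguments.
Unset Strict Implicit.
Unset Printing Implicit Defensive.

Import Order.TTheory GRing.Theory Num.Theory.

Local Open Scope classical_set_scope.
Local Open Scope ring_scope.

Section Dynamics.
Context {R : realType} {X : metricType R}.
Implicit Types (T : X -> X) (x y p q : X) (S K C : set X).

(* [T] is not required to be invertible. *)
Definition is_TDS T := compact [set: X] /\ continuous T.

Definition forward_orbit T x : set X := [set iter n T x | n in [set: nat]].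

Definition transitive_point T x := closure (forward_orbit T x) = [set: X].

Definition has_period T x (n : nat) :=
  [/\ (0 < n)%N, iter n T x = x
    & forall i, (0 < i < n)%N -> iter i T x <> x].

Definition periodic_point T x := exists n, has_period T x n.

(* The term [n = 0] is [0], and is irrelevant to the limits below. *)
Definition mean_dist T x y (n : nat) : R :=
  n%:R^-1 * \sum_(i < n) mdist (iter i T x) (iter i T y).

(* Upper and lower limits are taken in [\bar R], where they always exist. *)
Definition mean_liminf T x y : \bar R :=
  limn_einf (fun n => (mean_dist T x y n)%:E).

Definition mean_limsup T x y : \bar R :=
  limn_esup (fun n => (mean_dist T x y n)%:E).

Definition mean_proximal T x y := mean_liminf T x y = 0%E.

Definition mean_sensitive T :=
  exists2 delta : R, 0 < delta &
    forall x (eps : R), 0 < eps ->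
      exists2 y, ball x eps y & (delta%:E < mean_limsup T x y)%E.

Definition mean_LY_pair T x y :=
  mean_proximal T x y /\ (0 < mean_limsup T x y)%E.

Definition mean_LY_pair_mod T (eta : R) x y :=
  mean_proximal T x y /\ (eta%:E <= mean_limsup T x y)%E.

Definition mean_LY_set T S :=
  forall x y, S x -> S y -> x <> y -> mean_LY_pair T x y.

Definition mean_LY_set_mod T (eta : R) S :=
  forall x y, S x -> S y -> x <> y -> mean_LY_pair_mod T eta x y.

Definition mean_LY_chaotic T :=
  exists S, ~ countable S /\ mean_LY_set T S.

End Dynamics.

Definition homeomorphic (A B : topologicalType) :=
  exists (f : A -> B) (g : B -> A),
    [/\ continuous f, continuous g, cancel f g & cancel g f].

(* [C] is viewed as the subtype [set_type C], with the topology induced by the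
   inclusion into [X]. *)
Definition cantor_set (X : topologicalType) (C : set X) :=
  homeomorphic cantor_space (set_type C).

(* Indexing by [nat] covers nonempty finite unions, by repetition, but excludes
   the empty union. *)
Definition countable_union_of_cantor_sets (X : topologicalType) (K : set X) :=
  exists C : nat -> set X,
    (forall n, cantor_set (C n)) /\ K = \bigcup_n C n.

(* Main.v *)
Require Import Defs.
From mathcomp Require Import all_boot all_order all_algebra.
From mathcomp Require Import all_classical all_reals all_analysis.
From mathcomp Require Import zify lra.

(** The set K is a single Cantor set, obtained by a Mycielski argument from
    relations that are open and dense in a square U x U, and eta is half of the
    sensitivity constant delta.

    Two points x, y form a mean Li-Yorke pair with modulus eta as soon as, for
    all large k, some average of length at least k of the distances along their
    orbits is below 1/(k+1) ([close_after]) and another one is above eta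
    ([far_after]).  Both conditions are open in (x, y).  Distance averages obey
    the triangle inequality, so if the average of (x, x') exceeds delta then
    that of (x, y) or of (x', y) exceeds delta/2: mean sensitivity therefore
    makes [far_after] dense in X x X ([dense_far_after]).

    For [close_after], let n be the period of p.  If i and j are congruent
    modulo n, then T^i p = T^j p, and over the long times for which the orbits
    of p and q are close on average, those of T^i q and T^j q are both close on
    average to that of this common point, hence to each other
    ([close_after_iter]).  The orbit of q is dense in X,
    but two open sets need not be visited at times that are congruent modulo n
    (X may split into pieces that T permutes).  They are if both lie in an open
    set U visited in as few residue classes as possible, since then every
    nonempty open subset of U is visited in the same classes as U
    ([common_residue]).

    Finally [mycielski] builds, by a Cantor scheme in U, a continuous map f from
    the Cantor space such that any two distinct points have images satisfying
    both relations for all large k.  The lower bound eta on the upper mean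
    distance forces f to be injective, so by compactness its range is a Cantor
    set ([cantor_set_range]); it is uncountable ([uncountable_range]). *)

Import Order.TTheory GRing.Theory Num.Theory.
Import numFieldNormedType.Exports.
Local Open Scope classical_set_scope.
Local Open Scope ring_scope.

(** * Upper and lower limits through infinitely many indices *)

Lemma limn_esup_gt_frequently {R : realType} (u : (\bar R)^nat) (c : \bar R) :
  (c < limn_esup u)%E -> forall N, exists2 m, (N <= m)%N & (c < u m)%E.
Proof.
move=> cu N.
have : (c < ereal_sup (u @` [set m | (N <= m)%N]))%E.
  apply: (lt_le_trans cu); apply: ereal_inf_lbound.
  by exists [set m | (N <= m)%N] => //; exists N.
by move=> /ereal_sup_gt[_ [m Nm <-] cum]; exists m.
Qed.

Lemma limn_esup_ge_frequently {R : realType} (u : (\bar R)^nat) (c : \bar R) :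
  (forall N, exists2 m, (N <= m)%N & (c <= u m)%E) -> (c <= limn_esup u)%E.
Proof.
move=> cu; apply: le_ereal_inf_tmp => _ [A [N _ NA] <-].
have [m Nm cum] := cu N; apply: (le_trans cum); apply: ereal_sup_ubound.
by exists m => //; exact: NA.
Qed.

Lemma limn_einf_lt_frequently {R : realType} (u : (\bar R)^nat) (c : \bar R) :
  (limn_einf u < c)%E -> forall N, exists2 m, (N <= m)%N & (u m < c)%E.
Proof.
rewrite /limn_einf -lteNl => /limn_esup_gt_frequently cu N.
by have [m Nm] := cu N; rewrite lteN2; exists m.
Qed.

Lemma limn_einf_le_frequently {R : realType} (u : (\bar R)^nat) (c : \bar R) :
  (forall N, exists2 m, (N <= m)%N & (u m <= c)%E) -> (limn_einf u <= c)%E.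
Proof.
move=> cu; rewrite /limn_einf leeNl; apply: limn_esup_ge_frequently => N.
by have [m Nm umc] := cu N; exists m => //; rewrite leeN2.
Qed.

(** * Mycielski's theorem *)

(** Density of [O] in [U `*` U], tested on open rectangles. *)
Definition open_dense_in {X : topologicalType} (U : set X) (O : set (X * X)) :=
  open O /\ forall V W, open V -> open W -> V !=set0 -> W !=set0 ->
    V `<=` U -> W `<=` U -> exists x y, [/\ V x, W y & O (x, y)].

Lemma open_rectangle {X Y : topologicalType} (O : set (X * Y)) x y :
  open O -> O (x, y) -> exists A B,
    [/\ open A, open B, A x, B y & A `*` B `<=` O].
Proof.
move=> oO Oxy; have [[A B] /= [nA nB] ABO] : nbhs (x, y) O.
  exact: open_nbhs_nbhs.
exists A^°, B^°; split=> //; try exact: open_interior.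
by move=> [u v] [/interior_subset Au /interior_subset Bv]; exact: ABO.
Qed.

(** Openness of [O] is what lets the density of [P] be used again inside a
    rectangle contained in [O]. *)
Lemma open_dense_inI {X : topologicalType} (U : set X) (O P : set (X * X)) :
  open_dense_in U O -> open_dense_in U P -> open_dense_in U (O `&` P).
Proof.
move=> [oO dO] [oP dP]; split; first exact: openI.
move=> V W oV oW V0 W0 VU WU.
have [x [y [Vx Wy Oxy]]] := dO _ _ oV oW V0 W0 VU WU.
have [A [B [oA oB Ax By ABO]]] := open_rectangle _ _ _ oO Oxy.
have [||||||x' [y' [[Vx' Ax'] [Wy' By'] Pxy']]] :=
    dP (V `&` A) (W `&` B).
- exact: openI.
- exact: openI.
- by exists x.
- by exists y.
- by move=> z [/VU].
- by move=> z [/WU].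
by exists x', y'; split=> //; split=> //; exact: ABO.
Qed.

(** The pairs of [s] are treated one at a time; the inclusions already obtained
    survive further shrinking. *)
Lemma shrink_pairs {X : topologicalType} {I : eqType} (U : set X)
    (O : set (X * X)) (V : I -> set X) (s : seq (I * I)) :
  open_dense_in U O ->
  (forall i, [/\ open (V i), V i !=set0 & V i `<=` U]) ->
  exists V' : I -> set X,
    (forall i, [/\ open (V' i), V' i !=set0 & V' i `<=` V i]) /\
    (forall i j, (i, j) \in s -> i != j -> V' i `*` V' j `<=` O).
Proof.
move=> [oO dO] hV; elim: s => [|[i j] s [W [hW sW]]].
  by exists V; split=> // i; have [? ? _] := hV i; split.
have [ij|nij] := eqVneq i j.
  exists W; split=> // a b; rewrite inE => /orP[/eqP[-> ->]|]; last exact: sW.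
  by rewrite ij eqxx.
have [oWi Wi0 WVi] := hW i; have [oWj Wj0 WVj] := hW j.
have [_ _ VUi] := hV i; have [_ _ VUj] := hV j.
have [x [y [Wx Wy Oxy]]] := dO _ _ oWi oWj Wi0 Wj0
  (subset_trans WVi VUi) (subset_trans WVj VUj).
have [A [B [oA oB Ax By ABO]]] := open_rectangle _ _ _ oO Oxy.
pose W' a := if a == i then W i `&` A else
             if a == j then W j `&` B else W a.
have W'W a : W' a `<=` W a.
  by rewrite /W'; do 2 (case: eqP => [->|_]; first by move=> z []).
exists W'; split=> [a|a b].
  have [oWa Wa0 WVa] := hW a; split; last exact: (subset_trans (W'W a)).
  - by rewrite /W'; do 2 (case: ifP => _;
      first exact: openI).
  - rewrite /W'; case: eqP => _; first by exists x.
    by case: eqP => _ //; exists y.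
rewrite inE => /orP[/eqP[-> ->] _ [u v] /= []|abs nab [u v] [/= ua vb]].
  rewrite /W' eqxx (negbTE (_ : j != i)) 1?eq_sym// eqxx.
  move=> [_ Au] [_ Bv].
  exact: ABO.
by apply: (sW a b abs nab); split; exact: W'W.
Qed.

Lemma shrink_ball {R : realType} {X : pseudoMetricType R} (V : set X) (e : R) :
  open V -> V !=set0 -> 0 < e ->
  exists W : set X, [/\ open W, W !=set0, closure W `<=` V &
    exists x, W `<=` ball x e].
Proof.
move=> oV [x Vx] e0.
have [r /= r0 rV] := (@nbhs_ballP R X _ _).1 (open_nbhs_nbhs (conj oV Vx)).
pose m := Num.min e (r / 2).
have m0 : 0 < m by rewrite lt_min e0 divr_gt0.
exists (ball x m)^°; split.
- exact: open_interior.
- by exists x; exact: nbhsx_ballx.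
- move=> y cy; apply: rV; rewrite [r]splitr.
  have r20 : 0 < r / 2 by rewrite divr_gt0.
  have [z [/interior_subset xz yz]] := cy _ (nbhsx_ballx y _ r20).
  apply: (@ball_triangle _ _ z); last exact: ball_sym.
  by apply: le_ball xz; rewrite ge_min lexx orbT.
- exists x => y /interior_subset; apply: le_ball.
  by rewrite ge_min lexx.
Qed.

(** The newest bit comes first, so that [behead] maps the code of a prefix to the
    code of the prefix one bit shorter. *)
Fixpoint prefix_code (sigma : nat -> bool) (k : nat) : seq bool :=
  if k is j.+1 then sigma j :: prefix_code sigma j else [::].

Lemma size_prefix_code sigma k : size (prefix_code sigma k) = k.
Proof. by elim: k => //= k ->. Qed.

Lemma prefix_code_neq sigma tau i k : sigma i != tau i -> (i < k)%N ->
  prefix_code sigma k != prefix_code tau k.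
Proof.
move=> nst; elim: k => //= k IH; rewrite ltnS leq_eqVlt eqseq_cons negb_and.
by move=> /orP[/eqP <-|/IH ->]; rewrite ?nst ?orbT.
Qed.

Lemma prefix_code_near (sigma : cantor_space) k :
  \forall tau \near sigma, prefix_code tau k = prefix_code sigma k.
Proof.
elim: k => [|k IH]; first by apply: (@filterE _ (nbhs sigma)) => tau.
have : \forall tau \near sigma, (tau : cantor_space) k = sigma k.
  have /(_ [set sigma k]) := @proj_continuous _ (fun _ : nat => bool) k sigma.
  by apply; exact: discrete_set1.
by apply: filterS2 IH => tau /= -> ->.
Qed.

(** One level of the Cantor scheme.  Closures of the new cells lie in the parent
    cells, which yields points in all cells of a branch; their radii tend to
    zero, which yields continuity; and distinct cells of the new level are
    related by [O]. *)
Lemma mycielski_step {R : realType} {X : pseudoMetricType R} (U : set X)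
    (O : set (X * X)) (V : seq bool -> set X) (k : nat) :
  open_dense_in U O ->
  (forall s, [/\ open (V s), V s !=set0 & V s `<=` U]) ->
  exists V' : seq bool -> set X,
    [/\ forall s, [/\ open (V' s), V' s !=set0 & V' s `<=` U],
        forall s, closure (V' s) `<=` V (behead s),
        forall s, exists x, V' s `<=` ball x (k.+1%:R^-1 : R) &
        forall s t, size s = k.+1 -> size t = k.+1 -> s != t ->
          V' s `*` V' t `<=` O].
Proof.
move=> hO hV.
have /choice[W hW] : forall s : seq bool, exists W : set X,
    [/\ open W, W !=set0, closure W `<=` V (behead s) &
      exists x, W `<=` ball x (k.+1%:R^-1 : R)].
  move=> s; have [oV V0 _] := hV (behead s).
  by apply: shrink_ball => //; rewrite invr_gt0 ltr0Sn.
have hWU s : [/\ open (W s), W s !=set0 & W s `<=` U].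
  have [oW W0 cW _] := hW s; have [_ _ VU] := hV (behead s); split => //.
  exact: subset_trans (@subset_closure _ _) (subset_trans cW VU).
pose words := [seq tval t | t : k.+1.-tuple bool].
have [V' [hV' V'O]] :=
  shrink_pairs U O W [seq (s, t) | s <- words, t <- words] hO hWU.
have in_words s : size s = k.+1 -> s \in words.
  by move=> /eqP hs; apply/mapP; exists (Tuple hs); rewrite ?mem_enum.
exists V'; split=> [s|s|s|s t hs ht].
- have [oV' V'0 V'W] := hV' s; have [_ _ WU] := hWU s; split=> //.
  exact: subset_trans WU.
- have [_ _ V'W] := hV' s; have [_ _ cW _] := hW s.
  by apply: subset_trans cW; exact: closure_subset.
- have [_ _ V'W] := hV' s; have [_ _ _ [x Wx]] := hW s.
  by exists x; exact: subset_trans Wx.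
- by apply: V'O; apply/allpairsP; exists (s, t); split=> //; exact: in_words.
Qed.

(** Level [k.+1] of the scheme takes care of [O k] for the pairs that are
    separated by then, hence a conclusion for all large [k] only.  When the
    relations exclude the diagonal, [f] is injective. *)
Theorem mycielski {R : realType} {X : pseudoMetricType R} (U : set X)
    (O : nat -> set (X * X)) :
  compact [set: X] -> open U -> U !=set0 ->
  (forall k, open_dense_in U (O k)) ->
  exists f : cantor_space -> X, continuous f /\
    forall sigma tau : cantor_space, sigma <> tau ->
      exists k0, forall k, (k0 <= k)%N -> O k (f sigma, f tau).
Proof.
move=> cX oU U0 hO.
pose good (V : seq bool -> set X) :=
  forall s, [/\ open (V s), V s !=set0 & V s `<=` U].
have /choice[next nextP] : forall kV : nat * (seq bool -> set X),
    exists V' : seq bool -> set X, good kV.2 ->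
    [/\ good V',
        forall s, closure (V' s) `<=` kV.2 (behead s),
        forall s, exists x, V' s `<=` ball x (kV.1.+1%:R^-1 : R) &
        forall s t, size s = kV.1.+1 -> size t = kV.1.+1 -> s != t ->
          V' s `*` V' t `<=` O kV.1].
  move=> [k V]; have [gV|ngV] := pselect (good V); last by exists V.
  by have [V' hV'] := mycielski_step U (O k) V k (hO k) gV; exists V'.
pose scheme := fix scheme k : seq bool -> set X :=
  if k is j.+1 then next (j, scheme j) else fun=> U.
have gS k : good (scheme k).
  elim: k => [s|k IH] /=; first by split.
  by have [] := nextP (k, scheme k) IH.
have {nextP}hS k := nextP (k, scheme k) (gS k).
pose cell (sigma : nat -> bool) k := scheme k (prefix_code sigma k).
have cellS sigma k : closure (cell sigma k.+1) `<=` cell sigma k.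
  by have [_ + _ _] := hS k; apply.
have cell_le sigma j k : (j <= k)%N -> cell sigma k `<=` cell sigma j.
  elim: k => [|k IH]; first by rewrite leqn0 => /eqP ->.
  rewrite leq_eqVlt => /orP[/eqP -> //|/IH]; apply: subset_trans.
  by apply: subset_trans (cellS sigma k); exact: subset_closure.
have /choice[f fP] : forall sigma : cantor_space,
    exists z, forall k, cell sigma k z.
  move=> sigma.
  have /choice[x xP] : forall k, exists x, cell sigma k x.
    by move=> k; have [_ ? _] := gS k (prefix_code sigma k).
  have [z [_ zx]] := cX (x @ \oo) _ filterT.
  (* The cluster point is in the closure of every cell of the branch, so in every
     cell. *)
  exists z => k; apply: cellS => B Bz; apply: (zx _ _ _ Bz).
  by exists k.+1 => // m /= km; exact: cell_le (xP m).
exists f; split.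
- move=> sigma; apply/cvg_ballP => e e0.
  have [k ke] : exists k, 2 * k.+1%:R^-1 < e.
    have e20 : 0 < e / 2 by rewrite divr_gt0.
    have [k _ /(_ k (leqnn _)) /=] := near_infty_natSinv_lt (PosNum e20).
    by rewrite ltr_pdivlMr// mulrC; exists k.
  near=> tau; have tsk : prefix_code tau k.+1 = prefix_code sigma k.+1.
    by near: tau; exact: prefix_code_near.
  have [_ _ /(_ (prefix_code sigma k.+1))[x Vx] _] := hS k.
  apply: (le_ball (ltW ke)); rewrite mulr2n mulrDl mul1r.
  apply: (@ball_triangle _ _ x).
    by apply: ball_sym; apply: Vx; exact: (fP sigma k.+1).
  by apply: Vx; rewrite -tsk; exact: (fP tau k.+1).
- move=> sigma tau nst.
  have [i nsti] : exists i, sigma i != tau i.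
    apply: contra_notP nst => /forallNP st; apply/funext => i.
    by apply/eqP/negPn/negP; exact: st.
  exists i => k ik; have [_ _ _ +] := hS k.
  move=> /(_ (prefix_code sigma k.+1) (prefix_code tau k.+1)).
  apply; rewrite ?size_prefix_code//; first exact: prefix_code_neq nsti _.
  by split; [exact: (fP sigma k.+1)|exact: (fP tau k.+1)].
Unshelve. all: by end_near. Qed.

(** * Ranges of maps defined on the Cantor space *)

(** A continuous injection from a compact space into a Hausdorff space is closed,
    which gives the continuity of its inverse on the range. *)
Lemma cantor_set_range {R : realType} {X : metricType R}
    (f : cantor_space -> X) :
  continuous f -> injective f -> cantor_set (range f).
Proof.
move=> cf injf.
have mem_range sigma : f sigma \in range f by apply/mem_set; exists sigma.
pose F sigma : set_type (range f) := SigSub (mem_range sigma).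
have /choice[G FK] : forall y : set_type (range f), exists sigma, F sigma = y.
  move=> y; have /set_mem[sigma _ fs] := valP y.
  by exists sigma; exact: val_inj.
have cF : continuous F by apply: continuous_comp_initial.
have GK : cancel F G.
  by move=> sigma; apply: injf; have /(congr1 val) := FK (F sigma).
exists F, G; split=> //; apply/continuous_closedP => A cA.
have -> : G @^-1` A = set_val @^-1` (f @` A).
  apply/seteqP; split=> [y Ay|y [sigma As fs]] /=.
    by exists (G y) => //; rewrite -[in RHS](FK y).
  by have -> : y = F sigma; [exact/val_inj|rewrite GK].
apply: (continuous_closedP _).1; first exact: initial_continuous.
apply: compact_closed; first exact: metric_hausdorff.
apply: continuous_compact; first exact: continuous_subspaceT.
exact: subclosed_compact cA cantor_space_compact _.
Qed.

(** Cantor's diagonal argument: an injection [h] of the Cantor space into [nat]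
    would be contradicted at [diag], the sequence that holds at [n] when no
    sequence sent to [n] by [h] holds at [n]. *)
Lemma uncountable_range {X : Type} (f : (nat -> bool) -> X) :
  injective f -> ~ countable (range f).
Proof.
move=> injf /countable_injP[g injg].
have injh : injective (g \o f).
  move=> s t /= gfst; apply: injf; apply: injg => //.
  - by apply/mem_set; exists s.
  - by apply/mem_set; exists t.
pose diag n := `[< forall s, g (f s) = n -> ~~ s n >].
have [dn|/negP dn] := boolP (diag (g (f diag))).
  by have /asboolP/(_ diag erefl) := dn; rewrite dn.
apply: dn; apply/asboolP => s /injh ->; apply/negP => dn.
by have /asboolP/(_ diag erefl) := dn; rewrite dn.
Qed.

(** * Visit times in a common residue class *)

(** Shrinking an open set shrinks the set of residues of its visit times, so an
    open set with the least number of residues has the same residues as each of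
    its nonempty open subsets. *)
Lemma common_residue {Y : topologicalType} (x : nat -> Y) (n : nat) :
  (0 < n)%N -> [set: Y] !=set0 ->
  (forall V, open V -> V !=set0 -> exists i, V (x i)) ->
  exists U : set Y, [/\ open U, U !=set0 &
    forall V W, open V -> open W -> V !=set0 -> W !=set0 ->
      V `<=` U -> W `<=` U ->
      exists i j, [/\ (i %% n = j %% n)%N, V (x i) & W (x j)]].
Proof.
move=> n0 Y0 dx.
pose visits (V : set Y) : {set 'I_n} :=
  finset (fun a : 'I_n => `[< exists2 i, V (x i) & (i %% n)%N = a >]).
pose P k := `[< exists V, [/\ open V, V !=set0 & #|visits V| = k] >].
have exP : exists k, P k.
  exists #|visits setT|; apply/asboolP; exists setT.
  by split=> //; exact: openT.
case: (ex_minnP exP) => k /asboolP[U [oU U0 Uk]] mink.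
exists U; split=> // V W oV oW V0 W0 VU WU.
have visitsE Z : open Z -> Z !=set0 -> Z `<=` U -> visits Z = visits U.
  move=> oZ Z0 ZU; apply/eqP; rewrite eqEcard; apply/andP; split.
    apply/fintype.subsetP => a; rewrite !finset.in_set => /asboolP[i Zi ia].
    by apply/asboolP; exists i; first exact: ZU.
  by rewrite Uk; apply: mink; apply/asboolP; exists Z.
have [i Vi] := dx V oV V0.
have : Ordinal (ltn_pmod i n0) \in visits V.
  by rewrite finset.in_set; apply/asboolP; exists i.
rewrite (visitsE V)// -(visitsE W)// finset.in_set => /asboolP[j Wj /= ji].
by exists i, j; split=> //; rewrite ji.
Qed.

(** * Averages of distances along orbits *)

Section MeanDist.
Context {R : realType} {X : metricType R} (T : X -> X).
Implicit Types (x y z p q : X).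

Lemma mean_distxx x n : mean_dist T x x n = 0.
Proof. by rewrite /mean_dist big1 ?mulr0// => i _; rewrite mdistxx. Qed.

Lemma mean_dist_sym x y n : mean_dist T x y n = mean_dist T y x n.
Proof.
by rewrite /mean_dist; congr (_ * _); apply: eq_bigr => i _; rewrite metric_sym.
Qed.

Lemma mean_dist_ge0 x y n : 0 <= mean_dist T x y n.
Proof.
apply: mulr_ge0; rewrite ?invr_ge0//.
by apply: sumr_ge0 => i _; exact: mdist_ge0.
Qed.

Lemma mean_dist_triangle y x z n :
  mean_dist T x z n <= mean_dist T x y n + mean_dist T y z n.
Proof.
rewrite -mulrDr -big_split ler_wpM2l ?invr_ge0//.
by apply: ler_sum => i _; exact: metric_triangle.
Qed.

(** The sum over the times from [a] to [a + m - 1] is part of the sum over the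
    first [M] times, and normalizing by [m] instead of [M] costs at most a factor 2.
    The same [m] serves all shifts [a <= M - m]. *)
Lemma mean_dist_iter_le x y a m M : (a + m <= M <= m + m)%N ->
  mean_dist T (iter a T x) (iter a T y) m <= 2 * mean_dist T x y M.
Proof.
move=> /andP[amM Mmm]; rewrite /mean_dist.
case: m => [|m] in amM Mmm *.
  by rewrite big_ord0 mulr0 mulr_ge0//; exact: mean_dist_ge0.
have M0 : (0 < M)%N by apply: leq_trans amM; rewrite addnS.
rewrite mulrA; apply: ler_pM; rewrite ?invr_ge0//.
- by apply: sumr_ge0 => i _; exact: mdist_ge0.
- rewrite ler_pdivlMr ?ltr0n// mulrC ler_pdivrMr ?ltr0n//.
  by rewrite -natrM ler_nat mul2n -addnn.
- rewrite -!(big_mkord xpredT (fun i => mdist (iter i T _) (iter i T _))).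
  rewrite (big_cat_nat _ (n := a) (p := M))//=; last first.
    by apply: leq_trans amM; exact: leq_addr.
  rewrite [X in _ <= _ + X](big_cat_nat _ (n := (a + m.+1)%N))//=; last first.
    exact: leq_addr.
  rewrite addrCA -[X in X <= _]addr0; apply: lerD.
    rewrite -{3}[a]add0n big_addn addKn.
    by apply: ler_sum => i _; rewrite !iterD.
  by apply: addr_ge0; apply: sumr_ge0 => i _; exact: mdist_ge0.
Qed.

Lemma mdist_continuous : continuous (fun xy : X * X => mdist xy.1 xy.2 : R^o).
Proof.
move=> [x y]; apply/cvgrPdist_lt => e e0.
have e20 : 0 < e / 2 by rewrite divr_gt0.
exists (ball x (e / 2), ball y (e / 2)).
  by split; apply: nbhsx_ballx.
move=> [u v] /= []; rewrite !ballEmdist/= => xu yv.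
have := metric_triangle x u y; have := metric_triangle u v y.
have := metric_triangle u x v; have := metric_triangle x y v.
rewrite (metric_sym u x) (metric_sym v y) => h1 h2 h3 h4.
by rewrite ltr_norml; apply/andP; split; lra.
Qed.

Lemma mean_dist_continuous n : continuous T ->
  continuous (fun xy : X * X => mean_dist T xy.1 xy.2 n : R^o).
Proof.
move=> cT.
have ci i : continuous (iter i T).
  elim: i => [|i IH] x; first exact: cvg_id.
  by apply: continuous_comp; [exact: IH|exact: cT].
have cd i : continuous (fun xy : X * X =>
    mdist (iter i T xy.1) (iter i T xy.2) : R^o).
  move=> xy; apply: (@continuous_comp _ _ _
    (fun xy : X * X => (iter i T xy.1, iter i T xy.2))
    (fun xy => mdist xy.1 xy.2 : R^o)); last exact: mdist_continuous.
  by apply: cvg_pair; (apply: continuous_comp; last exact: ci);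
    [exact: cvg_fst|exact: cvg_snd].
move=> xy; rewrite /mean_dist; apply: cvgMr.
apply: (@continuous_big _ _ +%R (0 : R^o) xpredT) => //.
exact: add_continuous.
Qed.

(** One index [k] controls both the length of the average and the threshold, so
    that membership for all large [k] expresses mean proximality. *)
Definition close_after (k : nat) : set (X * X) :=
  [set xy | exists2 m, (k <= m)%N & mean_dist T xy.1 xy.2 m < k.+1%:R^-1].

Definition far_after (eta : R) (k : nat) : set (X * X) :=
  [set xy | exists2 m, (k <= m)%N & eta < mean_dist T xy.1 xy.2 m].

Lemma open_close_after k : continuous T -> open (close_after k).
Proof.
move=> cT; have -> : close_after k = \bigcup_(m in [set m | (k <= m)%N])
    (fun xy : X * X => mean_dist T xy.1 xy.2 m : R^o)
      @^-1` [set r | r < k.+1%:R^-1].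
  by apply/seteqP; split=> xy [m km h]; exists m.
apply: bigcup_open => m _; apply: open_comp; last exact: open_lt.
by move=> xy _; exact: mean_dist_continuous.
Qed.

Lemma open_far_after eta k : continuous T -> open (far_after eta k).
Proof.
move=> cT; have -> : far_after eta k = \bigcup_(m in [set m | (k <= m)%N])
    (fun xy : X * X => mean_dist T xy.1 xy.2 m : R^o) @^-1` [set r | eta < r].
  by apply/seteqP; split=> xy [m km h]; exists m.
apply: bigcup_open => m _; apply: open_comp; last exact: open_gt.
by move=> xy _; exact: mean_dist_continuous.
Qed.

Lemma mean_proximal_of_close_after x y k0 :
  (forall k, (k0 <= k)%N -> close_after k (x, y)) -> mean_proximal T x y.
Proof.
move=> cxy; apply/eqP; rewrite eq_le; apply/andP; split; last first.
  rewrite leNgt; apply/negP => /limn_einf_lt_frequently/(_ 0%N)[m _].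
  by rewrite lte_fin ltNge mean_dist_ge0.
apply/lee_addgt0Pr => e e0; rewrite add0e.
apply: limn_einf_le_frequently => N.
have [K _ Ke] := near_infty_natSinv_lt (PosNum e0).
have [|m km mlt] := cxy (maxn k0 (maxn N K)); first exact: leq_maxl.
exists m.
  by apply: leq_trans km; rewrite !leq_max leqnn orbT.
rewrite lee_fin; apply/ltW/(lt_trans mlt)/Ke => /=.
by rewrite !leq_max leqnn !orbT.
Qed.

Lemma mean_limsup_of_far_after eta x y k0 :
  (forall k, (k0 <= k)%N -> far_after eta k (x, y)) ->
  (eta%:E <= mean_limsup T x y)%E.
Proof.
move=> fxy; apply: limn_esup_ge_frequently => N.
have [|m km mlt] := fxy (maxn k0 N); first exact: leq_maxl.
exists m; last by rewrite lee_fin ltW.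
by apply: leq_trans km; exact: leq_maxr.
Qed.

(** If some average of (x, x') exceeds [delta], then for any [y] the average of
    (x, y) or of (x', y) over the same time exceeds [delta / 2]. *)
Lemma dense_far_after (delta : R) k (U : set X) : continuous T ->
  (forall x (e : R), 0 < e ->
    exists2 y, ball x e y & (delta%:E < mean_limsup T x y)%E) ->
  open_dense_in U (far_after (delta / 2) k).
Proof.
move=> cT sens; split; first exact: open_far_after.
move=> V W oV _ [x Vx] [y Wy] _ _.
have [e /= e0 eV] := (@nbhs_ballP R X _ _).1 (open_nbhs_nbhs (conj oV Vx)).
have [x' xx' /limn_esup_gt_frequently/(_ k)[m km]] := sens x e e0.
rewrite lte_fin => dm.
have := mean_dist_triangle y x x' m; rewrite (mean_dist_sym y) => tri.
have [xy|yx] := ltP (delta / 2) (mean_dist T x y m).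
  by exists x, y; split=> //; exists m.
exists x', y; split=> //; first exact: eV.
by exists m => //=; lra.
Qed.

(** The triangle inequality through [iter i T p = iter j T p] needs both averages
    to be small over the same window; [mean_dist_iter_le] provides this with
    [m = M - c] for both shifts.  Each side contributes a factor 2, whence the
    threshold [k.+1%:R^-1 / 4]. *)
Lemma close_after_iter p q i j k : mean_proximal T p q ->
  iter i T p = iter j T p -> close_after k (iter i T q, iter j T q).
Proof.
move=> pq pij; pose c := maxn i j.
have k40 : 0 < k.+1%:R^-1 / 4 :> R by rewrite divr_gt0// invr_gt0.
have : (mean_liminf T p q < (k.+1%:R^-1 / 4)%:E)%E by rewrite pq lte_fin.
move=> /limn_einf_lt_frequently/(_ (k + c + c)%N)[M kM].
rewrite lte_fin => Mlt.
have ci : (i <= c)%N by exact: leq_maxl.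
have cj : (j <= c)%N by exact: leq_maxr.
exists (M - c)%N; first by lia.
have := @mean_dist_iter_le p q i (M - c) M ltac:(lia).
have := @mean_dist_iter_le p q j (M - c) M ltac:(lia).
have := mean_dist_triangle (iter i T p) (iter i T q) (iter j T q) (M - c).
rewrite /= {2}pij (mean_dist_sym _ (iter i T p)) => h1 h2 h3.
by move: (k.+1%:R^-1) Mlt => e Mlt; lra.
Qed.

Lemma iter_period p n i : iter n T p = p -> iter i T p = iter (i %% n) T p.
Proof.
move=> np; rewrite {1}(divn_eq i n) addnC iterD; congr (iter _ T _).
by rewrite iterM iter_fix.
Qed.

Lemma transitive_visits q (V : set X) : transitive_point T q ->
  open V -> V !=set0 -> exists i, V (iter i T q).
Proof.
move=> tq oV [x Vx]; have : closure (forward_orbit T q) x by rewrite tq.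
move=> /(_ V (open_nbhs_nbhs (conj oV Vx)))[_ [[i _ <-] Vi]].
by exists i.
Qed.

End MeanDist.

Theorem theorem1p1 (R : realType) (X : metricType R) (T : X -> X)
    (hT : is_TDS T) (hsens : mean_sensitive T)
    (hpq : exists p q : X,
       [/\ mean_proximal T p q, periodic_point T p & transitive_point T q]) :
  mean_LY_chaotic T /\
  exists (eta : R) (K : set X),
    [/\ 0 < eta, countable_union_of_cantor_sets K & mean_LY_set_mod T eta K].
Proof.
have [cX cT] := hT; have [delta delta0 sens] := hsens.
have [p [q [pq [n [n0 np _]] tq]]] := hpq.
have eta0 : 0 < delta / 2 by rewrite divr_gt0.
have [||U [oU U0 hU]] := common_residue (fun i => iter i T q) n n0.
- by exists p.
- by move=> V; exact: transitive_visits tq.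
pose O k := close_after T k `&` far_after T (delta / 2) k.
have hO k : open_dense_in U (O k).
  apply: open_dense_inI; last exact: dense_far_after.
  split; first exact: open_close_after.
  move=> V W oV oW V0 W0 VU WU.
  have [i [j [ij Vi Wj]]] := hU V W oV oW V0 W0 VU WU.
  exists (iter i T q), (iter j T q); split=> //.
  apply: close_after_iter pq _.
  by rewrite (iter_period _ _ _ i np) (iter_period _ _ _ j np) ij.
have [f [cf fO]] := mycielski U O cX oU U0 hO.
have LY s t : s <> t -> mean_LY_pair_mod T (delta / 2) (f s) (f t).
  move=> /fO[k0 Ok]; split.
    by apply: mean_proximal_of_close_after => k /Ok[].
  by apply: mean_limsup_of_far_after => k /Ok[].
have injf : injective f.
  move=> s t fst; apply: contrapT => /LY[_]; rewrite fst.
  move=> /(lt_le_trans (_ : 0 < (delta / 2)%:E)%E)-/(_ eta0).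
  move=> /limn_esup_gt_frequently/(_ 0%N)[m _].
  by rewrite mean_distxx ltxx.
have hK : mean_LY_set_mod T (delta / 2) (range f).
  by move=> _ _ [s _ <-] [t _ <-] fst; apply: LY => st; apply: fst; rewrite st.
split.
  exists (range f); split; first exact: uncountable_range.
  move=> x y Kx Ky xy; have [? le] := hK x y Kx Ky xy; split=> //.
  by apply: lt_le_trans le; rewrite lte_fin.
exists (delta / 2), (range f); split=> //.
exists (fun=> range f); split; first by move=> _; exact: cantor_set_range.
by rewrite bigcup_const//; exists 0%N.
Qed.
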